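(* Let $\mathcal{B}=(a_1,a_2)\subset\mathbb{R}$, $\tau>0$, let $\rho_0>0$ and $c$ be constants, let $z=(z_0,z_1)=(t,x)$ and $\partial_\mu=\partial/\partial z_\mu$. Let $\dot D=\dot D(t,x)$ be a given smooth function on $[0,\tau]\times\mathcal{B}$ and let $$\sigma=\frac{\rho_0}{2}\left(\frac{\partial I}{\partial t}\right)^2-\frac{c}{2}\left(\frac{\partial I}{\partial x}\right)^2-\dot D\,\frac{\partial I}{\partial x}.$$ Let $I$ be a smooth solution on $[0,\tau]\times\mathcal{B}$ of the Euler–Lagrange equation $\frac{\partial}{\partial z_\mu}\left(\frac{\partial\sigma}{\partial(\partial_\mu I)}\right)=0$, i.e. of $\rho_0\,\partial_t^2 I-c\,\partial_x^2 I-\partial_x\dot D=0$. Then the tensor $$T_{\mu\eta}=\frac{\partial\sigma}{\partial(\partial_\mu I)}\cdot\frac{\partial I}{\partial z_\eta}-\delta_{\mu\eta}\,\sigma,\qquad\mu,\eta\in\{0,1\},$$ satisfies $$\frac{\partial T_{\mu\eta}}{\partial z_\mu}=-\frac{\partial\sigma}{\partial\dot D}\,\frac{\partial\dot D}{\partial z_\eta},\qquad\eta=0,1 .$$ In particular, $\pi:=T_{00}$ satisfies $$\frac{\partial\pi}{\partial t}+\frac{\partial}{\partial x}\left(\frac{\partial I}{\partial t}\,\frac{\partial\sigma}{\partial(\partial_x I)}\right)=\frac{\partial I}{\partial x}\,\frac{\partial\dot D}{\partial t}.$$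
   Context: Repeated index $\mu\in\{0,1\}$ is summed; $\delta_{\mu\eta}$ is the Kronecker delta. $\sigma$ is regarded as a function of $\partial_t I$, $\partial_x I$ and $\dot D$, so $\frac{\partial\sigma}{\partial(\partial_0 I)}=\rho_0\,\partial_t I$, $\frac{\partial\sigma}{\partial(\partial_1 I)}=\frac{\partial\sigma}{\partial(\partial_x I)}=-c\,\partial_x I-\dot D$, and $\frac{\partial\sigma}{\partial\dot D}=-\partial_x I$. The dot in $\dot D$ is part of its name. *)

(* Defs.v *)
From mathcomp Require Import all_boot all_order all_algebra.
From mathcomp Require Import all_classical all_reals all_analysis.

Set Implicit Arguments.
Unset Strict Implicit.
Unset Printing Implicit Defensive.

Import Order.TTheory GRing.Theory Num.Theory.
Import numFieldNormedType.Exports.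

Local Open Scope classical_set_scope.
Local Open Scope ring_scope.

(* Points z = (z_0, z_1) = (t, x) are row vectors; a function on
   [0, tau] x (a1, a2) is a total function of which only the values on
   [cylinder tau a1 a2] matter. *)
Definition cylinder (R : realType) (tau a1 a2 : R) : set 'rV[R]_2 :=
  [set z | z 0 0 \in `[0, tau] /\ z 0 1 \in `]a1, a2[].

Section PartialDerivatives.
Context {R : realType} (Om : set 'rV[R]_2).
Implicit Types (f : 'rV[R]_2 -> R) (mu : 'I_2) (z : 'rV[R]_2).

(* The library's directional derivative along the mu-th basis vector, except
   that the increment is restricted to those h for which the displaced point
   stays in Om. At interior points it is the usual partial derivative; on the
   faces t = 0 and t = tau it is one-sided in t. *)
Definition increments mu z : set_system R :=
  within [set h | Om (z + h *: delta_mx 0 mu)] (0 : R)^'.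

Definition diff_quot f mu z : R -> R :=
  fun h => h^-1 * (f (z + h *: delta_mx 0 mu) - f z).

Definition pderivable mu f z : Prop := cvg (diff_quot f mu z @ increments mu z).

Definition pderiv mu f : 'rV[R]_2 -> R :=
  fun z => lim (diff_quot f mu z @ increments mu z).

(* [:: mu1; ...; muk] stands for d_mu1 ... d_muk. *)
Definition iter_pderiv (s : seq 'I_2) f : 'rV[R]_2 -> R := foldr pderiv f s.

(* All iterated partial derivatives exist and are continuous on Om, up to the
   part of the boundary contained in Om. *)
Definition smooth_on f : Prop :=
  forall s : seq 'I_2,
    {within Om, continuous (iter_pderiv s f)} /\
    (forall mu z, Om z -> pderivable mu (iter_pderiv s f) z).

Definition pgrad f z : 'rV[R]_2 := \row_mu pderiv mu f z.

End PartialDerivatives.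

Section Lagrangian.
Context {R : realType} (rho0 c : R).

(* sigma as a function of p = (d_t I, d_x I) and of the value d of Ddot. *)
Definition sigma (p : 'rV[R]_2) (d : R) : R :=
  rho0 / 2 * p 0 0 ^+ 2 - c / 2 * p 0 1 ^+ 2 - d * p 0 1.

Definition dsigma_dp (mu : 'I_2) (p : 'rV[R]_2) (d : R) : R :=
  'D_(delta_mx 0 mu) (fun q : 'rV[R]_2 => sigma q d) p.

Definition dsigma_dD (p : 'rV[R]_2) (d : R) : R := derive1 (sigma p) d.

(* The same quantities along a field I with data Ddot, as functions of z. *)
Context (Om : set 'rV[R]_2) (I Ddot : 'rV[R]_2 -> R).

Definition sigma_at (z : 'rV[R]_2) : R := sigma (pgrad Om I z) (Ddot z).

Definition dsigma_dp_at (mu : 'I_2) (z : 'rV[R]_2) : R :=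
  dsigma_dp mu (pgrad Om I z) (Ddot z).

Definition dsigma_dD_at (z : 'rV[R]_2) : R :=
  dsigma_dD (pgrad Om I z) (Ddot z).

Definition euler_lagrange : Prop :=
  forall z, Om z -> \sum_(mu < 2) pderiv Om mu (dsigma_dp_at mu) z = 0.

Definition wave_equation : Prop :=
  forall z, Om z ->
    rho0 * pderiv Om 0 (pderiv Om 0 I) z - c * pderiv Om 1 (pderiv Om 1 I) z
      - pderiv Om 1 Ddot z = 0.

Definition tensorT (mu eta : 'I_2) (z : 'rV[R]_2) : R :=
  dsigma_dp_at mu z * pderiv Om eta I z - (mu == eta)%:R * sigma_at z.

End Lagrangian.

(* Main.v *)
(** By the chain rule, d_mu T_{mu eta} is the Euler-Lagrange expression times
    d_eta I, plus (dsigma/dp_mu) d_mu d_eta I - d_eta sigma. Expanding d_eta sigma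
    cancels everything except -(dsigma/dDdot) d_eta Ddot, provided the mixed
    partial derivatives of I commute. On the faces t = 0 and t = tau the partial
    derivatives are one-sided, but every point of the cylinder lies in
    arbitrarily small nondegenerate rectangles inside the cylinder, and the mean
    value theorem only uses interior points of their sides; so the usual proof
    by second differences works up to the boundary. *)
Require Import Defs.
From mathcomp Require Import all_boot all_order all_algebra.
From mathcomp Require Import all_classical all_reals all_analysis.
From mathcomp Require Import ring lra.

Import Order.TTheory GRing.Theory Num.Theory.
Import numFieldNormedType.Exports.

Local Open Scope classical_set_scope.
Local Open Scope ring_scope.

(** The relational form carries existence and value together, so the calculus rules hold for any
    [Om] and [z]. Uniqueness of the limit, hence properness of the filter, enters only when a value
    of [pderiv] is read off in [has_pderivE]. *)
Definition has_pderiv {R : realType} (Om : set 'rV[R]_2) (mu : 'I_2)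
    (f : 'rV[R]_2 -> R) (z : 'rV[R]_2) (l : R) : Prop :=
  diff_quot f mu z @ increments Om mu z --> l.

(** * Calculus rules for partial derivatives relative to a set *)

Section PartialDerivativeRules.
Context {R : realType} {Om : set 'rV[R]_2}.
Implicit Types (f g : 'rV[R]_2 -> R) (mu : 'I_2) (z : 'rV[R]_2) (l : R).

Global Instance increments_filter mu z : Filter (increments Om mu z).
Proof. exact: within_filter. Qed.

Lemma pderivable_has_pderiv {mu f z} :
  pderivable Om mu f z -> has_pderiv Om mu f z (pderiv Om mu f z).
Proof. by []. Qed.

Lemma has_pderiv_pderivable {mu f z l} :
  has_pderiv Om mu f z l -> pderivable Om mu f z.
Proof. by move=> fl; apply/cvg_ex; exists l. Qed.

Lemma has_pderiv_eq {mu f z l m} :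
  l = m -> has_pderiv Om mu f z l -> has_pderiv Om mu f z m.
Proof. by move=> ->. Qed.

Lemma has_pderivE {mu f z l} {pf : ProperFilter (increments Om mu z)} :
  has_pderiv Om mu f z l -> pderiv Om mu f z = l.
Proof. by move=> fl; apply: cvg_lim. Qed.

Lemma has_pderivD {mu f g z l m} : has_pderiv Om mu f z l ->
  has_pderiv Om mu g z m -> has_pderiv Om mu (fun x => f x + g x) z (l + m).
Proof.
move=> fl gm; rewrite /has_pderiv.
have -> : diff_quot (fun x => f x + g x) mu z =
    diff_quot f mu z \+ diff_quot g mu z.
  by apply/funext => h; rewrite /diff_quot /=; ring.
exact: cvgD.
Qed.

Lemma has_pderivZ {mu f z l} (k : R) : has_pderiv Om mu f z l ->
  has_pderiv Om mu (fun x => k * f x) z (k * l).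
Proof.
move=> fl; rewrite /has_pderiv.
have -> : diff_quot (fun x => k * f x) mu z = (fun h => k * diff_quot f mu z h).
  by apply/funext => h; rewrite /diff_quot /=; ring.
by apply: cvgM => //; exact: cvg_cst.
Qed.

Lemma increments_neq0 mu z : \forall h \near increments Om mu z, h != 0.
Proof. by apply: cvg_within; apply: (nbhs_dnbhs_neq (0 : R)). Qed.

Lemma increments_cvg0 mu z : (fun h : R => h) @ increments Om mu z --> (0 : R).
Proof. by apply: cvg_within_filter; exact: nbhs_dnbhs. Qed.

(** For nonzero [h] the shifted value is [f z] plus [h] times the difference quotient, so
    differentiability in direction [mu] gives continuity along that line. The product rule needs
    this for its shifted factor. *)
Lemma has_pderiv_cvg {mu f z l} : has_pderiv Om mu f z l ->
  (fun h => f (z + h *: delta_mx 0 mu)) @ increments Om mu z --> f z.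
Proof.
move=> fl.
have : (fun h => f z + h * diff_quot f mu z h) @ increments Om mu z
    --> f z + 0 * l.
  by apply: cvgD; [exact: cvg_cst | apply: cvgM => //; exact: increments_cvg0].
rewrite mul0r addr0; apply: cvg_trans; apply: near_eq_cvg.
near=> h.
have h0 : h != 0 by near: h; exact: increments_neq0.
by rewrite /diff_quot mulrA divff // mul1r addrC subrK.
Unshelve. all: by end_near. Qed.

Lemma has_pderivM {mu f g z l m} : has_pderiv Om mu f z l -> has_pderiv Om mu g z m ->
  has_pderiv Om mu (fun x => f x * g x) z (l * g z + f z * m).
Proof.
move=> fl gm; rewrite /has_pderiv.
have -> : diff_quot (fun x => f x * g x) mu z =
    (fun h => diff_quot f mu z h * g (z + h *: delta_mx 0 mu)
              + f z * diff_quot g mu z h).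
  by apply/funext => h; rewrite /diff_quot /=; ring.
apply: cvgD; apply: cvgM => //; last exact: cvg_cst.
exact: has_pderiv_cvg gm.
Qed.

(** * Mean value theorem and second differences along coordinate segments *)

Section Segment.
Context {f : 'rV[R]_2 -> R} {mu : 'I_2} {z : 'rV[R]_2} {h : R}.
Hypothesis segOm : forall s, s \in `[0, h] -> Om (z + s *: delta_mx 0 mu).

(** At an interior point of the segment, small increments of either sign stay in [Om]. The
    restriction built into [increments] is then vacuous near zero, and the relative partial
    derivative is an ordinary two-sided derivative. *)
Lemma segment_is_derive {s : R} :
  (forall y, Om y -> pderivable Om mu f y) -> s \in `]0, h[ ->
  is_derive s (1 : R) (fun s : R => f (z + s *: delta_mx 0 mu))
    (pderiv Om mu f (z + s *: delta_mx 0 mu)).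
Proof.
move=> fd sI; have sI' : s \in `[0, h] by exact: subset_itv_oo_cc sI.
set g := fun s : R => f _.
have gs : (fun r : R => r^-1 *: (g (r *: (1 : R) + s) - g s)) @ 0^' -->
    pderiv Om mu f (z + s *: delta_mx 0 mu).
  have -> : (fun r : R => r^-1 *: (g (r *: (1 : R) + s) - g s)) =
      diff_quot f mu (z + s *: delta_mx 0 mu).
    apply/funext => r; rewrite /diff_quot /g; congr (_ * (f _ - _)).
    by rewrite [r *: 1]mulr1 scalerDl addrA addrAC.
  move=> P /(pderivable_has_pderiv (fd _ (segOm _ sI'))) PP.
  have inOm : \forall r \near (0 : R)^',
      Om (z + s *: delta_mx 0 mu + r *: delta_mx 0 mu).
    apply: nbhs_dnbhs.
    have sr : (fun r : R => s + r) @ (0 : R) --> s.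
      rewrite -[X in _ --> X]addr0.
      by apply: cvgD; [exact: cvg_cst|exact: cvg_id].
    have := sr _ (near_in_itvoo sI); rewrite nbhs_simpl /=.
    apply: filterS => r rI.
    by rewrite -addrA -scalerDl; apply: segOm; exact: subset_itv_oo_cc rI.
  by apply: filterS2 inOm PP => r Hr; apply.
split; first by apply/cvg_ex; exists (pderiv Om mu f (z + s *: delta_mx 0 mu)).
by apply: cvg_lim.
Qed.

Lemma segment_continuous : {within Om, continuous f} ->
  {within `[0, h], continuous (fun s : R => f (z + s *: delta_mx 0 mu))}.
Proof.
move=> /subspace_continuousP fc; apply/subspace_continuousP => s sI.
move=> P /(fc _ (segOm _ sI)); rewrite /within /= => PP.
have lc : (fun r : R => z + r *: delta_mx 0 mu) @ s --> z + s *: delta_mx 0 mu.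
  by apply: cvgD; [exact: cvg_cst|apply: cvgZr_tmp; exact: cvg_id].
have := lc _ PP; rewrite !nbhs_simpl /=.
apply: filterS => r Pr rI; apply: Pr; exact: segOm.
Qed.

Lemma pderiv_mean_value : 0 < h -> {within Om, continuous f} ->
  (forall y, Om y -> pderivable Om mu f y) ->
  exists2 s, s \in `[0, h] &
    f (z + h *: delta_mx 0 mu) - f z =
    h * pderiv Om mu f (z + s *: delta_mx 0 mu).
Proof.
move=> h0 fc fd.
have [s sI E] := MVT h0 (fun s => segment_is_derive fd)
  (segment_continuous fc).
exists s; first exact: subset_itv_oo_cc sI.
by rewrite mulrC; move: E; rewrite scale0r addr0 subr0.
Qed.

End Segment.

(* Applying the mean value theorem first along [mu] and then along [nu] turns
   the second difference into a value of [d_nu d_mu f]; exchanging the roles of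
   the two directions gives a value of [d_mu d_nu f]. *)
Lemma second_difference {f mu nu z} {h k : R} : 0 < h -> 0 < k ->
  (forall s r, s \in `[0, h] -> r \in `[0, k] ->
    Om (z + s *: delta_mx 0 mu + r *: delta_mx 0 nu)) ->
  smooth_on Om f ->
  exists s r, [/\ s \in `[0, h], r \in `[0, k] &
    f (z + h *: delta_mx 0 mu + k *: delta_mx 0 nu)
      - f (z + h *: delta_mx 0 mu) - f (z + k *: delta_mx 0 nu) + f z =
    h * k * pderiv Om nu (pderiv Om mu f)
              (z + s *: delta_mx 0 mu + r *: delta_mx 0 nu)].
Proof.
move=> h0 k0 rect fs.
have k1 : k \in `[0, k] by rewrite in_itv /= ltW /=.
have k2 : 0 \in `[0, k] by rewrite in_itv /= lexx ltW.
have [fc fd] := fs [::]; have [f'c f'd] := fs [:: mu].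
have top s : s \in `[0, h] ->
    Om (z + k *: delta_mx 0 nu + s *: delta_mx 0 mu).
  by move=> sI; rewrite addrAC; exact: rect.
have bot s : s \in `[0, h] -> Om (z + s *: delta_mx 0 mu).
  by move=> sI; have := rect s 0 sI k2; rewrite scale0r addr0.
(* The mean value theorem is applied to the difference of [f] between two opposite sides of the
   rectangle, [top] and [bot], as a function of [s]; its increment over the whole side is the second
   difference. *)
have gd s (sI : s \in `]0, h[) := is_deriveB
  (segment_is_derive top (fd mu) sI) (segment_is_derive bot (fd mu) sI).
have gc : {within `[0, h], continuous
    ((fun s : R => f (z + k *: delta_mx 0 nu + s *: delta_mx 0 mu))
      - (fun s : R => f (z + s *: delta_mx 0 mu)))}.
  move=> s; apply: cvgB.
  - exact: (segment_continuous top fc).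
  - exact: (segment_continuous bot fc).
have [s /subset_itv_oo_cc sI E] := MVT h0 gd gc.
have [r rI E'] := pderiv_mean_value (fun r => rect s r sI) k0 f'c (f'd nu).
exists s, r; split => //.
move: E E'; rewrite /= !fctE !scale0r !addr0 subr0.
rewrite !(addrAC z (k *: _)) => E E'.
by rewrite -mulrA -E' mulrC -E; ring.
Qed.

End PartialDerivativeRules.

(** * Products of nondegenerate intervals, and symmetry of mixed derivatives up to the boundary *)

Section Box.
Context {R : realType} (J : 'I_2 -> interval R).
Hypothesis J_nondegenerate :
  forall mu, exists a b, [/\ a < b, a \in J mu & b \in J mu].
Implicit Types (f : 'rV[R]_2 -> R) (mu nu : 'I_2) (z w : 'rV[R]_2).

Let box : set 'rV[R]_2 := [set z | forall mu, z 0 mu \in J mu].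

Lemma subinterval_around {mu} {x d : R} : x \in J mu -> 0 < d ->
  exists a b, [/\ a < b, a <= x <= b, x - d < a, b < x + d &
    {subset `[a, b] <= J mu}].
Proof.
move=> xJ d0; have [a [b [ab aJ bJ]]] := J_nondegenerate mu.
have sub u v : u \in J mu -> v \in J mu -> {subset `[u, v] <= J mu}.
  move=> uJ vJ y; rewrite in_itv /= => /andP[uy yv].
  by apply: (@interval_is_interval _ (J mu) u v) => //; rewrite uy yv.
(* [x] may be an endpoint of [J mu], so the subinterval grows on one side only: to the right if [b]
   lies beyond [x], otherwise to the left, where [a] lies. The step [d / 2] makes the bounds
   strict. *)
have [xb|bx] := ltP x b.
- exists x, (Num.min b (x + d / 2)); split.
  + by rewrite lt_min xb /=; lra.
  + by rewrite lexx /= le_min ltW //=; lra.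
  + lra.
  + by rewrite gt_min; apply/orP; right; lra.
  + apply: (sub x _ xJ); apply: (sub x b xJ bJ).
    by rewrite in_itv /= le_min ge_min lexx /= (ltW xb) /=; lra.
- exists (Num.max a (x - d / 2)), x; split.
  + by rewrite gt_max (lt_le_trans ab bx) /=; lra.
  + by rewrite lexx andbT ge_max (ltW (lt_le_trans ab bx)) /=; lra.
  + by rewrite lt_max; apply/orP; right; lra.
  + lra.
  + apply: (sub _ x _ xJ); apply: (sub a x aJ xJ).
    by rewrite in_itv /= ge_max le_max lexx /= (ltW (lt_le_trans ab bx)) /=; lra.
Qed.

Lemma box_shift mu z (h : R) : box z -> z 0 mu + h \in J mu ->
  box (z + h *: delta_mx 0 mu).
Proof.
move=> zB hJ nu; rewrite !mxE eqxx /=.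
by have [->|ne] := eqVneq nu mu; rewrite ?mulr1 // mulr0 addr0.
Qed.

(** A small subinterval around the coordinate [z 0 mu] has two distinct endpoints; at least one
    differs from that coordinate and gives a nonzero admissible increment. *)
Lemma box_increments_proper mu z : box z -> ProperFilter (increments box mu z).
Proof.
move=> zB; apply: Build_ProperFilter_ex => P.
rewrite /increments /within /= => /nbhs_ballP[e /= e0 eP].
have [a [b [ab /andP[az zb] za bz sub]]] := subinterval_around (zB mu) e0.
have use y : y \in `[a, b] -> y != z 0 mu -> exists h, P h.
  move=> yI yz; exists (y - z 0 mu); apply: eP.
  - rewrite /ball /= sub0r normrN ltr_norml.
    by move: yI; rewrite in_itv /= => /andP[? ?]; apply/andP; split; lra.
  - by rewrite subr_eq0.
  - by apply: box_shift => //; rewrite addrC subrK; exact: sub.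
have [E|ne] := eqVneq a (z 0 mu).
  apply: (use b); first by rewrite in_itv /= lexx ltW.
  by rewrite -E gt_eqF.
by apply: (use a) => //; rewrite in_itv /= lexx ltW.
Qed.

(** On a small rectangle in the box containing [w], one second difference represents both mixed
    derivatives, each at its own point of the rectangle. The two values agree, and by continuity
    each is within [e / 2] of the corresponding value at [w]. *)
Lemma pderiv_comm f mu nu w : mu != nu -> smooth_on box f -> box w ->
  pderiv box mu (pderiv box nu f) w = pderiv box nu (pderiv box mu f) w.
Proof.
move=> ne fs wB; apply/eqP; rewrite -subr_eq0 -normr_le0.
apply/ler_addgt0Pr => e e0; rewrite add0r.
have e20 : 0 < e / 2 by lra.
have close (p q m : R) : `|p - m| < e / 2 -> `|q - m| < e / 2 -> `|p - q| <= e.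
  move=> pm qm; have -> : p - q = (p - m) - (q - m) by ring.
  by apply: (le_trans (ler_normB _ _)); lra.
have near_w (g : 'rV[R]_2 -> R) : {within box, continuous g} ->
    \forall y \near w, box y -> `|g w - g y| < e / 2.
  move=> /subspace_continuousP /(_ _ wB) /cvgrPdist_lt /(_ _ e20).
  by [].
have [d /= d0 dP] := (nbhs_ballP _ _).1
  (filterI (near_w _ (fs [:: mu; nu]).1) (near_w _ (fs [:: nu; mu]).1)).
have [a [b [ab /andP[aw wb] wa bw sub]]] :=
  subinterval_around (wB mu) d0.
have [a' [b' [ab' /andP[aw' wb'] wa' bw' sub']]] :=
  subinterval_around (wB nu) d0.
(* [z] is the lower corner of the rectangle with sides [[a, b]] and [[a', b']]; the point [w] lies
   somewhere in it, possibly on its edge. *)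
have [z zE] : exists z : 'rV[R]_2,
    forall i, z 0 i = if i == mu then a else if i == nu then a' else w 0 i.
  exists (\row_i if i == mu then a else if i == nu then a' else w 0 i) => i.
  by rewrite mxE.
have swap (s r : R) : z + s *: delta_mx 0 mu + r *: delta_mx 0 nu =
    z + r *: delta_mx 0 nu + s *: delta_mx 0 mu by exact: addrAC.
have rectE s r i :
    (z + s *: delta_mx 0 mu + r *: delta_mx 0 nu) 0 i =
    if i == mu then a + s else if i == nu then a' + r else w 0 i.
  rewrite !mxE zE !eqxx /=; case: (eqVneq i mu) => [->|_].
    by rewrite (negbTE ne) /=; ring.
  by case: (eqVneq i nu) => _ /=; ring.
have rectB s r : s \in `[0, b - a] -> r \in `[0, b' - a'] ->
    box (z + s *: delta_mx 0 mu + r *: delta_mx 0 nu).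
  rewrite !in_itv /= => /andP[? ?] /andP[? ?] i; rewrite rectE.
  case: (eqVneq i mu) => [->|_]; first by apply: sub; rewrite in_itv /=; lra.
  by case: (eqVneq i nu) => [->|_ //]; apply: sub'; rewrite in_itv /=; lra.
have rect_near s r : s \in `[0, b - a] -> r \in `[0, b' - a'] ->
    ball w d (z + s *: delta_mx 0 mu + r *: delta_mx 0 nu).
  rewrite !in_itv /= => /andP[? ?] /andP[? ?]; split => // i j.
  rewrite ord1 rectE /ball /= ltr_norml.
  case: (eqVneq j mu) => [->|_]; first by lra.
  by case: (eqVneq j nu) => [->|_]; [lra|rewrite subrr oppr_lt0 andbb].
have ba0 : 0 < b - a by lra.
have ba0' : 0 < b' - a' by lra.
have [s [r [sI rI E]]] := second_difference ba0 ba0' rectB fs.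
have rectB' r' s' : r' \in `[0, b' - a'] -> s' \in `[0, b - a] ->
    box (z + r' *: delta_mx 0 nu + s' *: delta_mx 0 mu).
  by move=> rI' sI'; rewrite -swap; exact: rectB.
have [r' [s' [rI' sI' E']]] := second_difference ba0' ba0 rectB' fs.
have {E E'} E : pderiv box nu (pderiv box mu f)
      (z + s *: delta_mx 0 mu + r *: delta_mx 0 nu) =
    pderiv box mu (pderiv box nu f)
      (z + s' *: delta_mx 0 mu + r' *: delta_mx 0 nu).
  (* Exchanging the two directions leaves the second difference unchanged, so dividing by the
     nonzero area equates the two mixed derivatives. *)
  have c0 : (b - a) * (b' - a') != 0 by rewrite mulf_neq0 ?gt_eqF.
  have cancel (p q u t x y m n : R) : p - q - u + t = x * y * m ->
      p - u - q + t = y * x * n -> x * y * m = x * y * n.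
    by move=> <-; rewrite (mulrC x) => <-; ring.
  apply: (mulfI c0); apply: cancel E _.
  by rewrite (swap (b - a)) (swap s' r') E'.
have [+ _] := dP _ (rect_near _ _ sI' rI'); move=> /(_ (rectB _ _ sI' rI')) /= L1.
have [_] := dP _ (rect_near _ _ sI rI); move=> /(_ (rectB _ _ sI rI)) /= L2.
by rewrite E in L2; exact: close L1 L2.
Qed.

End Box.

Lemma ord2_cases (i : 'I_2) : i = 0 \/ i = 1.
Proof. by case: i => -[|[|//]] ?; [left|right]; exact/val_inj. Qed.

Lemma big_ord2 {V : nmodType} (F : 'I_2 -> V) : \sum_(i < 2) F i = F 0 + F 1.
Proof.
by rewrite big_ord_recl big_ord1; congr (_ + F _); exact/val_inj.
Qed.

(** * Derivatives of the Lagrangian and divergence of the energy-momentum tensor *)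

Section EnergyMomentum.
Context {R : realType} (rho0 c : R).
Implicit Types (mu eta : 'I_2).

(** [sigma] is at most quadratic in each of its scalar arguments, so its increments have exactly
    this form; the one limit computed here serves for all its partial derivatives. *)
Lemma derive_quadratic {V : normedModType R} (f : V -> R) (a v : V) (A B : R) :
  (forall h, f (h *: v + a) - f a = h * (A + B * h)) -> 'D_v f a = A.
Proof.
move=> fE; apply: cvg_lim => //.
have : (fun h : R => A + B * h) @ (0 : R)^' --> A.
  rewrite -[X in _ --> X]addr0 -[X in _ --> _ + X](mulr0 B).
  apply: cvgD; [exact: cvg_cst|apply: cvgM; first exact: cvg_cst].
  exact: nbhs_dnbhs.
apply: cvg_trans; apply: near_eq_cvg; near=> h.
have h0 : h != 0 by near: h; exact: (nbhs_dnbhs_neq (0 : R)).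
by rewrite /= fE [_ *: _]mulrA mulVf // mul1r.
Unshelve. all: by end_near. Qed.

Lemma dsigma_dp0 (p : 'rV[R]_2) d : dsigma_dp rho0 c 0 p d = rho0 * p 0 0.
Proof.
apply: (@derive_quadratic _ _ _ _ _ (rho0 / 2)) => h.
by rewrite /sigma !mxE /=; field.
Qed.

Lemma dsigma_dp1 (p : 'rV[R]_2) d :
  dsigma_dp rho0 c 1 p d = - c * p 0 1 - d.
Proof.
apply: (@derive_quadratic _ _ _ _ _ (- (c / 2))) => h.
by rewrite /sigma !mxE /=; field.
Qed.

Lemma dsigma_dDE (p : 'rV[R]_2) d : dsigma_dD rho0 c p d = - p 0 1.
Proof.
rewrite /dsigma_dD derive1E; apply: (@derive_quadratic _ _ _ _ _ 0) => h.
by rewrite /sigma [h *: 1]mulr1; ring.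
Qed.

Context {Om : set 'rV[R]_2} {I Ddot : 'rV[R]_2 -> R}.
Hypothesis increments_proper :
  forall mu z, Om z -> ProperFilter (increments Om mu z).
Hypotheses (smoothI : smooth_on Om I) (smoothD : smooth_on Om Ddot).

Local Notation d_ mu f := (pderiv Om mu f).

Let dI mu := d_ mu I.

Lemma dsigma_dp_at0 :
  dsigma_dp_at rho0 c Om I Ddot 0 = fun z => rho0 * dI 0 z.
Proof. by apply/funext => z; rewrite /dsigma_dp_at dsigma_dp0 mxE. Qed.

Lemma dsigma_dp_at1 :
  dsigma_dp_at rho0 c Om I Ddot 1 = fun z => - c * dI 1 z + -1 * Ddot z.
Proof.
by apply/funext => z; rewrite /dsigma_dp_at dsigma_dp1 mxE mulN1r.
Qed.

Lemma dsigma_dD_atE z : dsigma_dD_at rho0 c Om I Ddot z = - dI 1 z.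
Proof. by rewrite /dsigma_dD_at dsigma_dDE mxE. Qed.

(** Squares become products and differences become multiples by [-1], so that the sum, scalar and
    product rules apply to the expression as written. *)
Lemma sigma_atE : sigma_at rho0 c Om I Ddot = fun z =>
  rho0 / 2 * (dI 0 z * dI 0 z)
    + (- (c / 2) * (dI 1 z * dI 1 z) + -1 * (Ddot z * dI 1 z)).
Proof.
by apply/funext => z; rewrite /sigma_at /sigma !mxE -!/(dI _ _); ring.
Qed.

Section At.
Context {z : 'rV[R]_2} (zOm : Om z).

Lemma has_pderiv_dI mu eta : has_pderiv Om mu (dI eta) z (d_ mu (dI eta) z).
Proof. exact: pderivable_has_pderiv ((smoothI [:: eta]).2 mu z zOm). Qed.

Lemma has_pderiv_Ddot mu : has_pderiv Om mu Ddot z (d_ mu Ddot z).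
Proof. exact: pderivable_has_pderiv ((smoothD [::]).2 mu z zOm). Qed.

Lemma has_pderiv_dsigma_dp mu nu :
  has_pderiv Om nu (dsigma_dp_at rho0 c Om I Ddot mu) z
    (if mu == 0 then rho0 * d_ nu (dI 0) z
     else - c * d_ nu (dI 1) z + -1 * d_ nu Ddot z).
Proof.
have [->|->] := ord2_cases mu.
  by rewrite dsigma_dp_at0; apply: has_pderivZ; exact: has_pderiv_dI.
rewrite dsigma_dp_at1 /=.
apply: has_pderivD; apply: has_pderivZ; first exact: has_pderiv_dI.
exact: has_pderiv_Ddot.
Qed.

Lemma has_pderiv_sigma mu : has_pderiv Om mu (sigma_at rho0 c Om I Ddot) z
  (rho0 * dI 0 z * d_ mu (dI 0) z + (- c * dI 1 z - Ddot z) * d_ mu (dI 1) z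
   - dI 1 z * d_ mu Ddot z).
Proof.
rewrite sigma_atE.
have d0 := has_pderiv_dI mu 0; have d1 := has_pderiv_dI mu 1.
have dD := has_pderiv_Ddot mu.
have d := has_pderivD (has_pderivZ (rho0 / 2) (has_pderivM d0 d0))
  (has_pderivD (has_pderivZ (- (c / 2)) (has_pderivM d1 d1))
    (has_pderivZ (-1) (has_pderivM dD d1))).
apply: has_pderiv_eq d.
move: (d_ mu (dI 0) z) (d_ mu (dI 1) z) (d_ mu Ddot z) => p q r.
by move: (dI 0 z) (dI 1 z) (Ddot z) => u v w; field.
Qed.

Lemma has_pderiv_tensorT mu eta nu :
  has_pderiv Om nu (tensorT rho0 c Om I Ddot mu eta) z
    (d_ nu (dsigma_dp_at rho0 c Om I Ddot mu) z * dI eta z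
     + dsigma_dp_at rho0 c Om I Ddot mu z * d_ nu (dI eta) z
     + - (mu == eta)%:R * d_ nu (sigma_at rho0 c Om I Ddot) z).
Proof.
have dp := has_pderiv_dsigma_dp mu nu; have ds := has_pderiv_sigma nu.
have pf := increments_proper nu _ zOm.
rewrite (has_pderivE dp) (has_pderivE ds).
have -> : tensorT rho0 c Om I Ddot mu eta = fun y =>
    dsigma_dp_at rho0 c Om I Ddot mu y * dI eta y
    + - (mu == eta)%:R * sigma_at rho0 c Om I Ddot y.
  by apply/funext => y; rewrite mulNr.
exact: has_pderivD (has_pderivM dp (has_pderiv_dI nu eta)) (has_pderivZ _ ds).
Qed.

(** Makes the Euler-Lagrange equation and the wave equation equivalent point by point. *)
Lemma divergence_dsigma_dp :
  \sum_(mu < 2) d_ mu (dsigma_dp_at rho0 c Om I Ddot mu) z =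
  rho0 * d_ 0 (dI 0) z - c * d_ 1 (dI 1) z - d_ 1 Ddot z.
Proof.
rewrite big_ord2.
have pf0 := increments_proper 0 _ zOm; have pf1 := increments_proper 1 _ zOm.
rewrite (has_pderivE (has_pderiv_dsigma_dp 0 0)).
rewrite (has_pderivE (has_pderiv_dsigma_dp 1 1)) /=.
by rewrite mulN1r mulNr addrA.
Qed.

Lemma divergence_tensorT eta :
  d_ 0 (dI 1) z = d_ 1 (dI 0) z ->
  \sum_(mu < 2) d_ mu (dsigma_dp_at rho0 c Om I Ddot mu) z = 0 ->
  \sum_(mu < 2) d_ mu (tensorT rho0 c Om I Ddot mu eta) z =
  dI 1 z * d_ eta Ddot z.
Proof.
have pf mu := increments_proper mu _ zOm.
rewrite !big_ord2.
move=> comm EL.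
rewrite !(has_pderivE (has_pderiv_tensorT _ _ _)).
rewrite !(has_pderivE (has_pderiv_sigma _)) dsigma_dp_at0 dsigma_dp_at1.
move: EL; rewrite dsigma_dp_at0 dsigma_dp_at1.
set P0 := pderiv _ 0 _ _; set P1 := pderiv _ 1 _ _ => EL.
(* [P0] and [P1] are the two summands of the Euler-Lagrange expression. They stay unexpanded: once
   [P1] is [- P0], their products with [dI eta] cancel, and with the mixed derivatives identified by
   [comm] a polynomial identity remains for each [eta]. *)
have {EL} -> : P1 = - P0 by apply/eqP; rewrite -addr_eq0 addrC EL.
have [->|->] := ord2_cases eta.
  rewrite /= comm; move: (d_ 1 (dI 0) z) (d_ 0 (dI 0) z) (d_ 0 Ddot z) => p q r.
  by move: P0 (dI 0 z) (dI 1 z) (Ddot z) => P u v w; ring.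
rewrite /= comm; move: (d_ 1 (dI 0) z) (d_ 1 (dI 1) z) (d_ 1 Ddot z) => p q r.
by move: P0 (dI 0 z) (dI 1 z) (Ddot z) => P u v w; ring.
Qed.

End At.
End EnergyMomentum.

(** * The space-time cylinder as a box, and the balance laws on it *)

Definition cylinder_sides {R : realType} (tau a1 a2 : R) (mu : 'I_2) :
  interval R := if mu == 0 then `[0, tau] else `]a1, a2[.

Lemma cylinder_box {R : realType} (tau a1 a2 : R) :
  cylinder tau a1 a2 =
  [set z | forall mu, z 0 mu \in cylinder_sides tau a1 a2 mu].
Proof.
apply/seteqP; split => [z [z0 z1] mu|z zB].
  by have [->|->] := ord2_cases mu.
by split; [exact: (zB 0)|exact: (zB 1)].
Qed.

Lemma cylinder_sides_nondegenerate {R : realType} {tau a1 a2 : R} :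
  a1 < a2 -> 0 < tau -> forall mu, exists a b,
  [/\ a < b, a \in cylinder_sides tau a1 a2 mu
    & b \in cylinder_sides tau a1 a2 mu].
Proof.
move=> a12 tau0 mu; rewrite /cylinder_sides; case: eqP => _.
  by exists 0, tau; rewrite !in_itv /= !lexx (ltW tau0).
(* The spatial side is open, so two distinct interior points replace the endpoints. *)
exists (a1 + (a2 - a1) / 3), (a1 + (a2 - a1) / 2).
by rewrite !in_itv /=; split; lra.
Qed.

Theorem mainTheorem10 (R : realType) (a1 a2 tau rho0 c : R)
  (I Ddot : 'rV[R]_2 -> R) :
  a1 < a2 -> 0 < tau -> 0 < rho0 ->
  let Om := cylinder tau a1 a2 in
  let d_ (mu : 'I_2) := pderiv Om mu in
  let T := tensorT rho0 c Om I Ddot in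
  smooth_on Om Ddot -> smooth_on Om I ->
  (euler_lagrange rho0 c Om I Ddot <-> wave_equation rho0 c Om I Ddot) /\
  (euler_lagrange rho0 c Om I Ddot ->
    (forall (eta : 'I_2) (z : 'rV[R]_2), Om z ->
      (forall mu : 'I_2, pderivable Om mu (T mu eta) z) /\
      \sum_(mu < 2) d_ mu (T mu eta) z
        = - dsigma_dD_at rho0 c Om I Ddot z * d_ eta Ddot z) /\
    (let flux := fun z => d_ 0 I z * dsigma_dp_at rho0 c Om I Ddot 1 z in
     forall z : 'rV[R]_2, Om z ->
      pderivable Om 1 flux z /\
      d_ 0 (T 0 0) z + d_ 1 flux z = d_ 1 I z * d_ 0 Ddot z)).
Proof.
move=> a12 tau0 _ Om d_ T sD sI.
have nondeg := cylinder_sides_nondegenerate a12 tau0.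
have OmB : Om = [set z | forall mu, z 0 mu \in cylinder_sides tau a1 a2 mu].
  exact: cylinder_box.
have pf mu z : Om z -> ProperFilter (increments Om mu z).
  by rewrite OmB; exact: box_increments_proper.
have comm z : Om z -> d_ 0 (d_ 1 I) z = d_ 1 (d_ 0 I) z.
  by move: sI; rewrite /d_ OmB => sI'; apply: pderiv_comm.
(* From here on the geometry of the cylinder enters only through [pf] and [comm]. *)
clearbody Om; split.
  by split=> eqn z zOm; have := eqn z zOm; rewrite (divergence_dsigma_dp _ _ pf).
move=> EL; have divT eta z (zOm : Om z) :=
  divergence_tensorT rho0 c pf sI sD zOm eta (comm z zOm) (EL z zOm).
have derT mu eta z (zOm : Om z) :=
  has_pderiv_pderivable (has_pderiv_tensorT rho0 c pf sI sD zOm mu eta mu).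
split=> [eta z zOm|flux z zOm].
  split=> [mu|]; first exact: derT.
  by rewrite dsigma_dD_atE opprK; exact: divT.
(* The Kronecker term vanishes off the diagonal, so the energy flux is a component of the tensor and
   the energy balance is the case [eta = 0]. *)
have -> : flux = T 1 0.
  by apply/funext => y; rewrite /flux /T /tensorT /= mul0r subr0 mulrC.
split; first exact: derT.
by rewrite -divT // big_ord2.
Qed.
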